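(* Let $K\subset[1,\infty)$ be compact with $1\in K$. Assume that $K$ has no accumulation points from the left, has only finitely many accumulation points from the right, and that its set $K'$ of accumulation points satisfies $(K'+K')\cap K'=\emptyset$. Then there exists a $K$-admissible periodic sphere packing $P$ of $\mathbb{R}$ with $\mathrm{dens}(P)=\Delta_1(K)$.
   Context: In dimension $1$, $B_1=[-1,1]$. A sphere packing of $\mathbb{R}$ is $P=X+\tfrac12B_1$ with $|x-y|\in\{0\}\cup[1,\infty)$ for $x,y\in X$; $\mathrm{dens}(P)=\limsup_{t\to\infty}\mathrm{vol}(P\cap[-t/2,t/2])/t$. $P$ is $K$-admissible if $|x-y|\in\{0\}\cup K\cup(\sup K,\infty)$ for all $x,y\in X$, and $\Delta_1(K)$ is the supremum of densities of $K$-admissible packings. $P$ is periodic if $X=\Lambda+Y$ with $\Lambda=\tau\mathbb{Z}$, $\tau>0$, and $Y$ finite nonempty. A point $p$ is an accumulation point of $K$ from the left (resp. right) if $(p-\varepsilon,p)\cap K\ne\emptyset$ (resp. $(p,p+\varepsilon)\cap K\neq\emptyset$) for every $\varepsilon>0$. *)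

(* Defs.v *)
From mathcomp Require Import all_boot all_order all_algebra.
From mathcomp Require Import all_classical all_reals all_analysis.

Set Implicit Arguments.
Unset Strict Implicit.
Unset Printing Implicit Defensive.

Import Order.TTheory GRing.Theory Num.Theory.
Import numFieldNormedType.Exports.

Local Open Scope classical_set_scope.
Local Open Scope ring_scope.

Definition minkowski_sum {R : realType} (A B : set R) : set R :=
  [set a + b | a in A & b in B].

(* The touching packing Z has the same point set [set: R] as 1/2 + Z, so the
   point set does not determine the centers: packings are represented below by
   their set of centers X. *)
Definition is_sphere_packing {R : realType} (X : set R) : Prop :=
  forall x y, X x -> X y -> ([set 0] `|` `[1, +oo[) `|x - y|.

Definition packing_set {R : realType} (X : set R) : set R :=
  minkowski_sum X [set 2^-1 * b | b in `[(-1 : R), 1]].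

Definition dens {R : realType} (P : set R) : \bar R :=
  limf_esup
    (fun t : R =>
       (lebesgue_measure (P `&` `[(- t / 2)%R, (t / 2)%R]%classic)
        * (t^-1)%:E)%E)
    (pinfty_nbhs R).

Definition admissible {R : realType} (K X : set R) : Prop :=
  is_sphere_packing X /\
  forall x y, X x -> X y -> ([set 0] `|` K `|` `]sup K, +oo[) `|x - y|.

Definition Delta1 {R : realType} (K : set R) : \bar R :=
  ereal_sup [set dens (packing_set X) | X in [set X | admissible K X]].

Definition lattice {R : realType} (tau : R) : set R :=
  range (fun k : int => k%:~R * tau).

Definition is_periodic_packing {R : realType} (X : set R) : Prop :=
  exists (tau : R) (Y : set R),
    [/\ 0 < tau, finite_set Y, Y !=set0 & X = minkowski_sum (lattice tau) Y].

Definition left_accumulation {R : realType} (K : set R) : set R :=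
  [set p | forall eps : R, 0 < eps -> `]p - eps, p[ `&` K !=set0].

Definition right_accumulation {R : realType} (K : set R) : set R :=
  [set p | forall eps : R, 0 < eps -> `]p, p + eps[ `&` K !=set0].

(* Main.v *)
(* Reading off consecutive gaps turns an admissible set of centers into a word
   over K (gaps above M = sup K may be shrunk to M) all of whose block sums lie
   in the closed set K \cup [M, +oo), and the density is the inverse of the mean
   gap.  Since K accumulates only from the right and K' + K' misses K', a
   compactness argument shows that rounding every gap slightly above an
   accumulation point p down to p keeps all block sums in that set.  The rounded
   gaps form a finite alphabet, and because gaps are at least 1 only blocks of
   bounded length matter.  The words are thus the walks in a finite graph, where
   the least mean is attained on a cycle, i.e. by a periodic packing. *)

Require Import Defs.
From mathcomp Require Import all_boot all_order all_algebra.
From mathcomp Require Import all_classical all_reals all_analysis.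
From mathcomp Require Import zify ring lra.

Import Order.TTheory GRing.Theory Num.Theory.
Import numFieldNormedType.Exports.

Local Open Scope classical_set_scope.
Local Open Scope ring_scope.

(** * Rounding gaps down to accumulation points *)

(** Along a single ultrafilter all positions of a sequence of words over a compact alphabet converge
    at once, which replaces a diagonal extraction of subsequences. *)
Lemma ultra_compact_cvg {T : topologicalType} {I : Type} {U : set_system I}
    {UF : UltraFilter U} (A : set T) (u : I -> T) :
  compact A -> (\forall l \near U, A (u l)) -> exists2 a, A a & u @ U --> a.
Proof.
move=> cA UA; have [a [Aa cla]] := cA (u @ U) _ UA; exists a => // V aV.
have [//|UV] := in_ultra_setVsetC (u @^-1` V) UF.
by have [x [/= nVx Vx]] := cla (~` V) V UV aV.
Qed.

Lemma ultra_bounded_nat {I : Type} {U : set_system I} {UF : UltraFilter U}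
    (u : I -> nat) (N : nat) :
  (\forall l \near U, (u l < N)%N) -> exists n, \forall l \near U, u l = n.
Proof.
elim: N => [U0|N IHN UN].
  by have [] := @filter_not_empty _ U _; apply: filterS U0 => l.
have [UuN|UuN] := in_ultra_setVsetC [set l | u l = N] UF; first by exists N.
by apply: IHN; apply: filterS2 UN UuN => l /=;
  rewrite ltnS leq_eqVlt => /predU1P[].
Qed.

(** The ray is closed at its endpoint so that limits of block sums stay in the set; this adds
    nothing as soon as [sup K] belongs to [K]. *)
Definition steps {R : realType} (K : set R) : set R := K `|` `[sup K, +oo[.

Lemma closed_steps {R : realType} (K : set R) : compact K -> closed (steps K).
Proof.
move=> cK; apply: closedU; last exact: interval_closed.
exact: compact_closed (@norm_hausdorff _ R) cK.
Qed.

Lemma steps_lt_sup {R : realType} (K : set R) (x : R) :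
  steps K x -> x < sup K -> K x.
Proof. by case=> //=; rewrite in_itv /= andbT => /le_lt_trans H /H;
  rewrite ltxx. Qed.

Lemma ge_sup_steps {R : realType} (K : set R) (x : R) :
  sup K <= x -> steps K x.
Proof. by right; rewrite /= in_itv /= andbT. Qed.

Lemma sup_in_compact {R : realType} (K : set R) :
  K !=set0 -> compact K -> K (sup K).
Proof.
move=> K0 cK; have /closure_id {1}-> := compact_closed (@norm_hausdorff _ R) cK.
by apply: closure_sup => //; have [] := compact_has_sup K0 cK.
Qed.

Lemma near_ge_of_left_accumulation0 {R : realType} {K : set R} :
  left_accumulation K = set0 -> forall a : R, \forall x \near a, K x -> a <= x.
Proof.
move=> K_left a; have : ~ left_accumulation K a by rewrite K_left.
rewrite /left_accumulation /= -existsNE => -[e /not_implyP[e0 Ke]].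
have : nbhs a [set x | a - e < x] by apply: lt_nbhsr; rewrite ltrBlDr ltrDl.
apply: filterS => x /= ex Kx; rewrite leNgt; apply/negP => xa; apply: Ke.
by exists x; split=> //; rewrite /= in_itv /= ex.
Qed.

Lemma limit_point_right_accumulation {R : realType} (K : set R) :
  left_accumulation K = set0 -> limit_point K `<=` right_accumulation K.
Proof.
move=> K_left a Ka e e0.
have aV : nbhs a [set x | (K x -> a <= x) /\ x < a + e].
  apply: filterI; first exact: near_ge_of_left_accumulation0.
  by apply: lt_nbhsl; rewrite ltrDl.
have [x [xa Kx [/(_ Kx) ax xe]]] := Ka _ aV.
by exists x; split=> //; rewrite /= in_itv /= xe andbT lt_neqAle eq_sym xa.
Qed.

Lemma limit_point_cvg_gt {R : realType} {I : Type} {U : set_system I}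
    {UF : ProperFilter U} (E : set R) (u : I -> R) (a : R) :
  u @ U --> a -> (\forall l \near U, E (u l)) -> (\forall l \near U, a < u l) ->
  limit_point E a.
Proof.
move=> ua UE Ugt V aV; have UV : U (u @^-1` V) := ua V aV.
have [l [[/= Vl El] al]] := filter_ex (filterI (filterI UV UE) Ugt).
by exists (u l); split=> //; rewrite gt_eqF.
Qed.

Lemma limit_point_finite {R : realType} (E : set R) :
  finite_set E -> limit_point E = set0.
Proof.
move=> finE; apply/seteqP; split=> // a /limit_point_infinite_setP.
by move=> /(_ setT filterT); rewrite setTI.
Qed.

(* Gaps slightly above an accumulation point [p] of [K] are rounded down to
   [p]; when several such [p] are within reach, an arbitrary one is chosen. *)
Definition snap {R : realType} (K : set R) (delta x : R) : R :=
  xget x [set p | limit_point K p /\ p < x < p + delta].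

Lemma snapP {R : realType} (K : set R) (delta x : R) : 0 < delta ->
  snap K delta x <= x < snap K delta x + delta /\
  (snap K delta x = x \/ limit_point K (snap K delta x)).
Proof.
move=> d0; rewrite /snap; case: xgetP => [p _ /= [Kp /andP[px ->]]|_].
  by rewrite ltW //; split=> //; right.
by rewrite lexx ltrDl d0; split=> //; left.
Qed.

Lemma snap_in {R : realType} (K : set R) (delta x : R) :
  compact K -> 0 < delta -> K x -> K (snap K delta x).
Proof.
move=> cK d0 Kx; have [_ [->//|/subset_limit_point]] := snapP K delta x d0.
by have /closure_id <- := compact_closed (@norm_hausdorff _ R) cK.
Qed.

(** A snapped letter is an accumulation point of [K] or a letter fixed by [snap]. Infinitely many
    fixed letters would accumulate at some [a] from the right, and those within [delta] of [a] would
    have been moved. *)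
Lemma finite_snap {R : realType} (K : set R) (delta : R) :
  compact K -> left_accumulation K = set0 -> finite_set (right_accumulation K)
    ->
  0 < delta -> finite_set (snap K delta @` K).
Proof.
move=> cK K_left K_right d0; pose E := K `&` [set x | snap K delta x = x].
have finK' : finite_set (limit_point K).
  exact: sub_finite_set (limit_point_right_accumulation K K_left) K_right.
suff finE : finite_set E.
  have : finite_set (limit_point K `|` E) by rewrite finite_setU.
  apply: sub_finite_set => _ [x Kx <-].
  by have [_ [Ex|]] := snapP K delta x d0; [right; split;
    rewrite /= ?Ex | left].
apply: contrapT => infE; have bE : bounded_set E.
  have [B [Breal KB]] := compact_bounded cK; exists B; split=> // y By x [Kx _].
  exact: KB.
have [a Ea] := infinite_bounded_limit_point_nonempty infE bE.
have Ka : limit_point K a.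
  by move=> V /Ea[y [ya [Ky _] Vy]]; exists y.
have aV : nbhs a [set x | (K x -> a <= x) /\ x < a + delta].
  apply: filterI; first exact: near_ge_of_left_accumulation0.
  by apply: lt_nbhsl; rewrite ltrDl.
have [x [xa [Kx Ex] [/(_ Kx) ax xd]]] := Ea _ aV.
have := Ex; rewrite /= /snap; case: xgetP => [p _ /= [_ /andP[px _]] pE|].
  by rewrite pE ltxx in px.
by move=> /(_ a)[]; split; rewrite // xd andbT lt_neqAle eq_sym xa.
Qed.

Definition good {R : realType} (K : set R) (d : nat -> R) : Prop :=
  (forall k, K (d k)) /\
  forall i j, (i < j)%N -> steps K (\sum_(i <= k < j) d k).

Lemma cvg_le_of_left_accumulation0 {R : realType} {K : set R} {I : Type}
    {U : set_system I} {UF : Filter U} {u : I -> R} {a : R} :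
  left_accumulation K = set0 -> u @ U --> a -> (forall l, K (u l)) ->
  \forall l \near U, a <= u l.
Proof.
move=> K_left ua uK.
have : U (u @^-1` [set x | K x -> a <= x]).
  by apply: ua; exact: near_ge_of_left_accumulation0.
by apply: filterS => l; apply.
Qed.

(** Near the limit the block sums of [d l] are below [sup K], hence in [K]. They exceed the limit
    strictly: no letter approaches its limit from below, and the first one stays strictly above. *)
Lemma limit_point_block {R : realType} {K : set R} {I : Type}
    {U : set_system I} {UF : ProperFilter U} {d : I -> nat -> R}
    {e : nat -> R} {i j : nat} :
  left_accumulation K = set0 -> (forall l, good K (d l)) ->
  (forall k, d ^~ k @ U --> e k) -> (i < j)%N ->
  \sum_(i <= k < j) e k < sup K -> (\forall l \near U, e i < d l i) ->
  limit_point K (\sum_(i <= k < j) e k).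
Proof.
move=> K_left d_good d_e ij e_lt ei.
have d_cvg : (fun l => \sum_(i <= k < j) d l k) @ U --> \sum_(i <= k < j) e k.
  by apply: cvg_big => //; exact: add_continuous.
have d_ge : \forall l \near U, forall k : 'I_j, e k <= d l k.
  apply: filter_forall => k; apply: (cvg_le_of_left_accumulation0 K_left (d_e
    k)).
  by move=> l; have [] := d_good l.
apply: (limit_point_cvg_gt _ _ _ d_cvg).
  apply: filterS (cvgr_lt _ d_cvg _ e_lt) => l.
  by apply: steps_lt_sup; have [_] := d_good l; apply.
apply: filterS2 ei d_ge => l eil d_gel; rewrite !(big_ltn ij).
rewrite ltr_leD // ler_sum_nat // => k /andP[_ kj].
exact: (d_gel (Ordinal kj)).
Qed.

(* Otherwise, by compactness of [K] there are good words whose snapped sums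
   fail for ever finer [delta], all of the same length and converging to a word
   [e]. At each position the snapped letter is eventually either the original
   one or its limit. All positions cannot be of the same kind, which yields two
   positions where the word converges strictly from above, and then the block
   between them contradicts [K_sum]. *)
Lemma good_snap {R : realType} {K : set R} (K_ge1 : K `<=` `[1, +oo[)
    (K_compact : compact K) (K_1 : K 1)
    (K_left : left_accumulation K = set0)
    (K_right : finite_set (right_accumulation K))
    (K_sum : minkowski_sum (limit_point K) (limit_point K) `&` limit_point K
      = set0) :
  exists2 delta : R, 0 < delta &
    forall d, good K d -> good K (snap K delta \o d).
Proof.
have K1 x : K x -> 1 <= x by move=> /K_ge1; rewrite /= in_itv /= andbT.
(* A block starting at [i] is a prefix of the word shifted by [i], and shifts of good words are
   good. *)
suff [delta d0 H] : exists2 delta : R, 0 < delta & forall d n, good K d ->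
    (0 < n)%N -> steps K (\sum_(0 <= k < n) snap K delta (d k)).
  exists delta => // d [Kd gd]; split=> [k|i j ij]; first exact: snap_in.
  rewrite -{1}[i]add0n big_addn; apply: (H (fun k => d (k + i)%N)).
    split=> [k|i' j' ij'] //; have := gd (i' + i)%N (j' + i)%N.
    by rewrite big_addn addnK ltn_add2r; apply.
  by rewrite subn_gt0.
apply: contrapT => /forall2NP H.
have delta_gt0 l : 0 < l.+1%:R^-1 :> R by rewrite invr_gt0.
have {}H (l : nat) : exists dn : (nat -> R) * nat, [/\ good K dn.1, (0 <
  dn.2)%N &
    ~ steps K (\sum_(0 <= k < dn.2) snap K l.+1%:R^-1 (dn.1 k))].
  have [//|] := H l.+1%:R^-1; move=> /existsNP[d /existsNP[n]].
  by move=> /not_implyP[dK /not_implyP[n0 nS]]; exists (d, n).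
have {H} [dn H] := choice H.
pose d l := (dn l).1; pose r l k := snap K l.+1%:R^-1 (d l k).
have d_good l : good K (d l) by have [] := H l.
have dK l k : K (d l k) by have [] := d_good l.
have rK l k : K (r l k) by exact: snap_in.
have [U [UF oo_U]] := @ultraFilterLemma nat \oo _.
have [n [n_gt0 nU]] : exists n, (0 < n)%N /\
    \forall l \near U, ~ steps K (\sum_(0 <= k < n) r l k).
  (* Snapped letters are at least 1 and a sum reaching [sup K] cannot fail, so the failing prefixes
     have bounded length. *)
  have [|n nU] := @ultra_bounded_nat _ U _ (snd \o dn) (Num.trunc (sup K)).+1.
    apply: nearW => l /=; have [_ _ nS] := H l.
    rewrite ltnNge; apply/negP => Kn; apply/nS/ge_sup_steps/ltW.
    apply: lt_le_trans (truncnS_gt (sup K)) _.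
    apply: (@le_trans _ _ (dn l).2%:R); first by rewrite ler_nat.
    by rewrite -[X in X%:R](subn0 (dn l).2) -sumr_const_nat;
      apply: ler_sum_nat => k _; apply: K1; exact: (rK l k).
  exists n; split; first by have [l /= <-] := filter_ex nU; have [] := H l.
  by apply: filterS nU => l /= <-; have [] := H l.
have /choice[e de] k : exists e, K e /\ d ^~ k @ U --> e.
  have [|e Ke de] := @ultra_compact_cvg _ _ U _ K (d ^~ k) K_compact.
    by apply: nearW => l; exact: dK.
  by exists e.
have eK k : K (e k) by have [] := de k.
have {}de k : d ^~ k @ U --> e k by have [] := de k.
have re k : r ^~ k @ U --> e k.
  have dl : (fun l => d l k - l.+1%:R^-1) @ U --> e k - 0.
    apply: cvgB; first exact: de.
    by move=> V V0; apply: oo_U; exact: (cvg_harmonic V0).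
  rewrite subr0 in dl; apply: squeeze_cvgr dl (de k).
  apply: nearW => l; have [/andP[rd dr] _] := snapP K _ (d l k) (delta_gt0 l).
  by rewrite rd lerBlDr ltW.
have ge_e (u : nat -> R) k : u @ U --> e k -> (forall l, K (u l)) ->
    \forall l \near U, e k <= u l.
  exact: cvg_le_of_left_accumulation0.
have le_rd l k : r l k <= d l k.
  by have [/andP[]] := snapP K _ (d l k) (delta_gt0 l).
pose A k := \forall l \near U, r l k = e k.
pose B k := \forall l \near U, r l k = d l k.
have AorB k : A k \/ B k.
  have [|rd] := in_ultra_setVsetC [set l | r l k = d l k] UF; first by right.
  have [|rNe] := in_ultra_setVsetC [set l | r l k = e k] UF; first by left.
  (* If neither holds, the snapped letters are accumulation points of [K] that tend to [e k]
     strictly from above, but [K] has only finitely many accumulation points. *)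
  suff : limit_point (limit_point K) (e k).
    by rewrite limit_point_finite //;
      apply: sub_finite_set (limit_point_right_accumulation K K_left) K_right.
  apply: (limit_point_cvg_gt _ _ _ (re k)).
    apply: filterS rd => l /= rNd.
    by have [_ []] := snapP K _ (d l k) (delta_gt0 l).
  apply: filterS2 rNe (ge_e _ _ (re k) (rK ^~ k)) => l /= rNe er.
  by rewrite lt_neqAle er andbT; apply/eqP => /esym.
have ABgt k : ~ (A k /\ B k) -> \forall l \near U, e k < d l k.
  (* If the original letter equals its limit, the snapped one is caught between the two, so both
     [A k] and [B k] hold. *)
  move=> nAB; have [ed|] := in_ultra_setVsetC [set l | d l k = e k] UF.
    have rE : A k.
      apply: filterS2 ed (ge_e _ _ (re k) (rK ^~ k)) => l /= dE er.
      by apply/eqP; rewrite eq_le er andbT -dE.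
    by case: nAB; split=> //; apply: filterS2 ed rE => l /= -> ->.
  apply: filterS2 (ge_e _ _ (de k) (dK ^~ k)) => l /= ed dNe.
  by rewrite lt_neqAle ed andbT; apply/eqP => /esym.
have e_ge0 k : 0 <= e k by rewrite (le_trans _ (K1 _ (eK k))).
have e_steps : steps K (\sum_(0 <= k < n) e k).
  apply: (@closed_cvg _ _ U _ (fun l => \sum_(0 <= k < n) d l k) (steps K)).
  - exact: closed_steps.
  - by apply: nearW => l; have [_] := d_good l; apply.
  - by apply: cvg_big => //; exact: add_continuous.
have all_near (Q : nat -> nat -> Prop) :
    (forall k, (k < n)%N -> \forall l \near U, Q k l) ->
    \forall l \near U, forall k, (k < n)%N -> Q k l.
  move=> HQ; have : \forall l \near U, forall k : 'I_n, Q k l.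
    by apply: filter_forall => k; exact: HQ.
  by apply: filterS => l QU k kn; exact: (QU (Ordinal kn)).
(* Otherwise the snapped sums, eventually at least the limit sum, would lie in the ray and not
   fail. *)
have e_lt : \sum_(0 <= k < n) e k < sup K.
  rewrite ltNge; apply/negP => Ke.
  have /all_near ger k : (k < n)%N -> \forall l \near U, e k <= r l k.
    by move=> _; apply: ge_e.
  have [l [nS er]] := filter_ex (filterI nU ger).
  apply/nS/ge_sup_steps/(le_trans Ke)/ler_sum_nat => k /andP[_ kn].
  exact: er.
(* If [A] held everywhere, the snapped sum would be the limit sum, which lies in the closed set
   [steps K]. *)
have [i in_ nAi] : exists2 i, (i < n)%N & ~ A i.
  apply: contrapT => /forall2NP nA; have /all_near rE k : (k < n)%N -> A k.
    by case: (nA k) => // /contrapT.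
  have [l [nS rl]] := filter_ex (filterI nU rE); apply: nS.
  rewrite (_ : \sum_(0 <= k < n) r l k = \sum_(0 <= k < n) e k) //.
  by apply: eq_big_nat => k /andP[_ kn]; exact: rl.
(* If [B] held everywhere, the snapped sum would be a block sum of the good word [d l]. *)
have [j jn nBj] : exists2 j, (j < n)%N & ~ B j.
  apply: contrapT => /forall2NP nB; have /all_near rE k : (k < n)%N -> B k.
    by case: (nB k) => // /contrapT.
  have [l [nS rl]] := filter_ex (filterI nU rE); apply: nS.
  rewrite (_ : \sum_(0 <= k < n) r l k = \sum_(0 <= k < n) d l k).
    by have [_] := d_good l; apply.
  by apply: eq_big_nat => k /andP[_ kn]; exact: rl.
have ij : i != j by apply/eqP => E; case: (AorB i) => [//|]; rewrite E.
have {nAi} gti : \forall l \near U, e i < d l i by apply: ABgt => -[].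
have {nBj} gtj : \forall l \near U, e j < d l j by apply: ABgt => -[].
wlog lt_ij : i j in_ jn ij gti gtj / (i < j)%N.
  move=> Hw; have [|ji|E] := ltngtP i j; first exact: Hw.
    by apply: (Hw j i) => //; rewrite eq_sym.
  by rewrite E eqxx in ij.
have sub_lt i' j' : (i' < j')%N -> (j' <= n)%N ->
    \sum_(i' <= k < j') e k < sup K.
  move=> ij' jn'; apply: le_lt_trans e_lt.
  rewrite (@big_cat_nat _ _ _ i' 0 n) ?(leq_trans (ltnW ij')) //=.
  rewrite (@big_cat_nat _ _ _ j' i' n) //=; last exact: ltnW.
  by rewrite addrCA lerDl addr_ge0 // sumr_ge0.
have ai := limit_point_block K_left d_good de lt_ij (sub_lt _ _ lt_ij (ltnW
  jn)) gti.
have bj := limit_point_block K_left d_good de (ltnSn j) (sub_lt _ _ (ltnSn j)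
  jn) gtj.
have ij1 : (i < j.+1)%N by exact: ltnW.
have abij := limit_point_block K_left d_good de ij1 (sub_lt _ _ ij1 jn) gti.
(* The block from [i] up to [j], the single letter at [j], and their concatenation all sum to
   accumulation points of [K]. *)
suff : (minkowski_sum (limit_point K) (limit_point K) `&` limit_point K)
    (\sum_(i <= k < j.+1) e k) by rewrite K_sum.
split; last exact: abij.
exists (\sum_(i <= k < j) e k); first exact: ai.
exists (\sum_(j <= k < j.+1) e k); first exact: bj.
by rewrite [RHS](@big_cat_nat _ _ _ j) //= ltnW.
Qed.

(** * Minimal mean cycles *)

Definition window {T : Type} (N : nat) (c : nat -> T) (i : nat) :
  {ffun 'I_N -> T} := [ffun t : 'I_N => c (i + t)%N].

Lemma window_eq {T : Type} {N : nat} {c c' : nat -> T} {i j : nat} :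
  window N c i = window N c' j <->
  forall t, (t < N)%N -> c (i + t)%N = c' (j + t)%N.
Proof.
split=> [/ffunP eq_w t tN | eq_c].
  by have := eq_w (Ordinal tN); rewrite !ffunE.
by apply/ffunP => t; rewrite !ffunE; apply: eq_c.
Qed.

Definition excise {T : Type} (i p : nat) (c : nat -> T) (k : nat) : T :=
  if (k < i)%N then c k else c (k + p)%N.

Definition repeat {T : Type} (i p : nat) (c : nat -> T) (k : nat) : T :=
  c (i + k %% p)%N.

(** Windows serve as vertices of a graph and sequences as walks; equal windows close a cycle. A
    window across the cut reads letters after [i + p], which agree with those after [i]. *)
Lemma window_excise {T : Type} {N i p : nat} {c : nat -> T} :
  window N c i = window N c (i + p) ->
  forall q, exists q', window N (excise i p c) q = window N c q'.
Proof.
move=> /window_eq eq_w q; have [qi|iq] := ltnP q i; last first.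
  exists (q + p)%N; apply/window_eq => t tN; rewrite /excise ltnNge.
  by rewrite (leq_trans iq (leq_addr _ _)) /= addnAC.
exists q; apply/window_eq => t tN; rewrite /excise; case: ltnP => // iqt.
have := eq_w (q + t - i)%N; rewrite addnAC subnKC // => -> //; lia.
Qed.

Lemma window_repeat {T : Type} {N i p : nat} {c : nat -> T} :
  (0 < p)%N -> window N c i = window N c (i + p) ->
  forall q, exists q', window N (repeat i p c) q = window N c q'.
Proof.
move=> p_gt0 /window_eq eq_w q; exists (i + q %% p)%N.
(* The two equal windows make [c] periodic on the [p + N] letters from [i] on, enough for every
   window that starts within the first period. *)
have eq_c k : (k < p + N)%N -> c (i + k %% p)%N = c (i + k)%N.
  elim/ltn_ind: k => k IHk kpN; have [kp|pk] := ltnP k p.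
    by rewrite modn_small.
  rewrite -{1}(subnK pk) modnDr IHk; [|lia|lia].
  have := eq_w (k - p)%N; rewrite -addnA subnKC // => -> //; lia.
apply/window_eq => t tN; rewrite /repeat -modnDml eq_c ?addnA //.
by rewrite -ltn_subRL (leq_trans tN) // leq_subRL; have := ltn_pmod q p_gt0;
  lia.
Qed.

(** Pigeonhole on windows; the bound on [i + p] keeps the periods to be considered in a finite
    range. *)
Lemma window_recurrence {T : finType} (N : nat) (c : nat -> T) :
  exists i p, [/\ (0 < p)%N, (i + p <= #|{ffun 'I_N -> T}|)%N &
    window N c i = window N c (i + p)].
Proof.
set L := #|_|; pose f (k : 'I_L.+1) := window N c k.
have /negP/injectivePn[x [y xy fxy]] : ~ injectiveb f.
  by move=> /injectiveP/leq_card; rewrite card_ord ltnn.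
wlog lt_xy : x y xy fxy / (x < y)%N.
  move=> Hw; have [|yx|/val_inj] := ltngtP x y; first exact: Hw.
    by apply: (Hw y x) => //; rewrite eq_sym.
  by move/eqP; rewrite (negbTE xy).
exists x, (y - x)%N; rewrite subn_gt0 lt_xy subnKC; last exact: ltnW.
by split=> //; have := ltn_ord y; rewrite ltnS.
Qed.

Lemma sum_excise {R : nmodType} {T : Type} (a : T -> R) (i p n : nat)
    (c : nat -> T) : (i + p <= n)%N ->
  \sum_(0 <= k < n) a (c k) =
  \sum_(0 <= k < n - p) a (excise i p c k)
    + \sum_(0 <= k < p) a (repeat i p c k).
Proof.
move=> ipn; rewrite (@big_cat_nat _ _ _ i 0 n) //=; last by lia.
rewrite (@big_cat_nat _ _ _ (i + p) i n) //=; last by lia.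
rewrite (@big_cat_nat _ _ _ i 0 (n - p)) //=; last by lia.
have -> : \sum_(0 <= k < i) a (excise i p c k) = \sum_(0 <= k < i) a (c k).
  by apply: eq_big_nat => k /andP[_ ki]; rewrite /excise ki.
have -> : \sum_(0 <= k < p) a (repeat i p c k) = \sum_(i <= k < i + p) a (c k).
  apply/esym/(etrans (big_addn 0 _ i _ _)); rewrite addKn.
  apply: eq_big_nat => k /andP[_ kp].
  by rewrite /repeat modn_small // addnC.
have -> : \sum_(i <= k < n - p) a (excise i p c k) =
    \sum_(i + p <= k < n) a (c k).
  rewrite big_addn; apply: eq_big_nat => k /andP[ik _].
  by rewrite /excise ltnNge ik.
by rewrite -addrA [X in _ + X]addrC.
Qed.

Definition window_admissible {T : Type} {N : nat} (W : set {ffun 'I_N -> T})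
  (c : nat -> T) : Prop := forall q, W (window N c q).

(* The minimal mean over all periodic sequences of bounded period is a global
   bound, since any long sequence contains such a cycle which can be excised. *)
Lemma min_mean_cycle {R : realType} {T : finType} {N : nat}
    (W : set {ffun 'I_N -> T}) (a : T -> R) (a_ge1 : forall t, 1 <= a t)
    (W0 : exists c, window_admissible W c) :
  exists (c : nat -> T) (p : nat) (mu B : R),
    [/\ (0 < p)%N, forall k, c (k + p)%N = c k & window_admissible W c] /\
    [/\ \sum_(0 <= k < p) a (c k) = p%:R * mu &
      forall c' n, window_admissible W c' ->
        n%:R * mu <= \sum_(0 <= k < n) a (c' k) + B].
Proof.
set L := #|{ffun 'I_N -> T}|.
(* A finite type coding sequences of period at most [L], so that a least mean exists: the first
   component is the period minus one, the second holds the letters, and entries past the period are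
   ignored. *)
pose cyc (x : 'I_L * {ffun 'I_L.+1 -> T}) (k : nat) : T :=
  x.2 (inord (k %% x.1.+1)).
pose mean (x : 'I_L * {ffun 'I_L.+1 -> T}) := (\sum_(0 <= k < x.1.+1) a (cyc x
  k)) / (x.1.+1)%:R.
pose P x := `[< window_admissible W (cyc x) >].
have cycE i p c : (0 < p)%N -> (i + p <= L)%N ->
    window N c i = window N c (i + p) -> window_admissible W c ->
    exists2 x, P x & x.1.+1 = p :> nat /\ cyc x =1 repeat i p c.
  move=> p0 ipL eq_w Wc; have p1L : (p.-1 < L)%N by lia.
  exists (Ordinal p1L, [ffun k : 'I_L.+1 => repeat i p c k]); last first.
    split; rewrite /cyc /= prednK // => k.
    rewrite ffunE inordK ?/repeat ?modn_mod // ltnS.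
    by rewrite (leq_trans (ltnW (ltn_pmod _ p0))) //; lia.
  apply/asboolP => q; have [q' Eq] := window_repeat p0 eq_w q.
  rewrite [window _ _ _](_ : _ = window N c q') //; rewrite -Eq.
  apply/window_eq => t tN; rewrite /cyc /= ffunE prednK //.
  rewrite inordK ?/repeat ?modn_mod // ltnS.
  by rewrite (leq_trans (ltnW (ltn_pmod _ p0))) //; lia.
have [c0 Wc0] := W0.
have [i0 [p0 [p0_gt0 ip0L eq0]]] := window_recurrence N c0.
have [x0 Px0 _] := cycE _ _ _ p0_gt0 ip0L eq0 Wc0.
case: (arg_minP mean Px0) => x Px x_min.
(* The error [L%:R * mean x] covers words of length at most [L]; a longer word contains a cycle of
   mean at least [mean x], whose removal costs nothing. *)
exists (cyc x), x.1.+1, (mean x), (L%:R * mean x).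
have mean_ge0 : 0 <= mean x.
  by rewrite divr_ge0 // sumr_ge0 // => k _; apply: le_trans (a_ge1 _).
split.
  by split => [//|k|]; [rewrite /cyc modnDr | apply/asboolP].
split; first by rewrite mulrCA mulfV ?mulr1 ?pnatr_eq0.
move=> c n; elim/ltn_ind: n c => n IHn c Wc; have [nL|Ln] := leqP n L.
  rewrite (le_trans (ler_wpM2r mean_ge0 (_ : _ <= L%:R))) ?ler_nat //.
  by rewrite lerDr sumr_ge0 // => k _; apply: le_trans (a_ge1 _).
have [i [p [p_gt0 ipL eq_w]]] := window_recurrence N c.
rewrite (sum_excise a i p) ?(leq_trans ipL (ltnW Ln)) //.
have [y Py [y_p y_cyc]] := cycE _ _ _ p_gt0 ipL eq_w Wc.
have : mean x <= mean y by apply: x_min.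
rewrite {2}/mean y_p ler_pdivlMr ?ltr0n //.
under eq_big_nat do rewrite y_cyc.
have Wex : window_admissible W (excise i p c).
  by move=> q; have [q' ->] := window_excise eq_w q.
have := IHn (n - p)%N _ _ Wex; rewrite natrB; last by lia.
move=> /(_ ltac:(lia)); rewrite mulrBl [mean x * _]mulrC.
by move: (\sum_(_ <= _ < _) _) (\sum_(_ <= _ < _) _) => s1 s2; lra.
Qed.

(** * Optimal gap words *)

Lemma sum_ge_sup_steps {R : realType} {K : set R} {d : nat -> R} {i j : nat} :
  (forall k, 1 <= d k) -> sup K <= (j - i)%:R ->
  steps K (\sum_(i <= k < j) d k).
Proof.
move=> d1 Kij; apply/ge_sup_steps/(le_trans Kij).
by rewrite -sumr_const_nat; apply: ler_sum_nat => k _; exact: d1.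
Qed.

Lemma optimal_gaps {R : realType} {K : set R} (K_ge1 : K `<=` `[1, +oo[)
    (K_compact : compact K) (K_1 : K 1)
    (K_left : left_accumulation K = set0)
    (K_right : finite_set (right_accumulation K))
    (K_sum : minkowski_sum (limit_point K) (limit_point K) `&` limit_point K
      = set0) :
  exists (d : nat -> R) (p : nat) (mu B : R),
    [/\ (0 < p)%N, forall k, d (k + p)%N = d k & good K d] /\
    [/\ \sum_(0 <= k < p) d k = p%:R * mu &
      forall d' n, good K d' -> n%:R * mu <= \sum_(0 <= k < n) d' k + B].
Proof.
have K1 x : K x -> 1 <= x by move=> /K_ge1; rewrite /= in_itv /= andbT.
have [delta d0 snap_good] :=
  good_snap K_ge1 K_compact K_1 K_left K_right K_sum.
have [s sE] := (finite_seqP _).1 (finite_snap K delta K_compact K_left K_right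
  d0).
have sK x : x \in s -> K x.
  move=> xs; have : [set` s] x by [].
  by rewrite -sE => -[y Ky <-]; exact: snap_in.
pose T : finType := seq_sub s; pose a (t : T) : R := ssval t.
have aK t : K (a t) by apply/sK/ssvalP.
have a1 t : 1 <= a t by apply/K1/aK.
(* Since [N] exceeds [sup K] and letters are at least 1, blocks longer than [N] impose no
   condition. *)
pose N := (Num.trunc (sup K)).+1.
(* Only blocks at the start of the window are tested; a block starting elsewhere is tested by the
   window that begins there. *)
pose W := [set f : {ffun 'I_N -> T} | forall j, (0 < j <= N)%N ->
  steps K (\sum_(k < N | (k < j)%N) a (f k))].
have sum_window c q j : (j <= N)%N ->
    \sum_(k < N | (k < j)%N) a (window N c q k) =
    \sum_(q <= k < q + j) a (c k).
  move=> jN; rewrite -{2}[q]add0n big_addn addKn big_mkord.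
  rewrite (big_ord_widen N (fun k => a (c (k + q)%N)) jN).
  by apply: eq_bigr => k _; rewrite ffunE addnC.
have WP c : window_admissible W c <-> good K (a \o c).
  split=> [Wc|[_ gc] q j /andP[j0 jN]]; last first.
    by rewrite sum_window //; apply: gc; rewrite -ltn_subLR // subnn.
  split=> [k|i j ij]; first exact: aK.
  have [jiN|Nji] := leqP (j - i) N.
    have /= := Wc i (j - i)%N; rewrite sum_window // subnKC ?(ltnW ij) //.
    by apply; rewrite subn_gt0 ij.
  apply: sum_ge_sup_steps => [k|]; first exact: a1.
  by rewrite (le_trans (ltW (truncnS_gt _))) // ler_nat ltnW.
have code d : good K d -> exists2 c : nat -> T,
    window_admissible W c & forall k, a (c k) = snap K delta (d k).
  move=> gd; have sd k : snap K delta (d k) \in s.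
    suff : [set` s] (snap K delta (d k)) by [].
    by rewrite -sE; exists (d k) => //; case: gd.
  exists (fun k => SeqSub (sd k)) => //.
  exact/WP/snap_good.
have [|c [p [mu [B [[p0 c_per Wc] [c_mu c_min]]]]]] :=
    min_mean_cycle W a a1.
  (* The constant word [sup K] is good, so at least one admissible walk exists. *)
  have [|c Wc _] := code (fun=> sup K); last by exists c.
  have supK : K (sup K) by apply: sup_in_compact => //; exists 1.
  split=> // i j ij; apply: ge_sup_steps; rewrite (big_ltn ij) lerDl.
  by apply: sumr_ge0 => _ _; apply: le_trans (K1 _ supK).
exists (a \o c), p, mu, B; split; first by split=> // [k|] /=;
  [rewrite c_per|exact/WP].
(* Snapping never raises a letter, so the lower bound for the snapped word passes to the original
   one. *)
split=> // d' n /code[c' Wc' c'E]; apply: le_trans (c_min c' n Wc') _.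
rewrite lerD2r; apply: ler_sum_nat => k _; rewrite c'E.
by have [/andP[]] := snapP K delta (d' k) d0.
Qed.

(** Gaps are capped at [sup K] and the finite list is continued by [sup K]. A block containing the
    letter [sup K] sums to at least [sup K]; any other block telescopes to the distance of two
    centers. *)
Lemma good_min_gap {R : realType} {K X : set R} (K_ge1 : K `<=` `[1, +oo[)
    (supK : K (sup K)) (x : nat -> R) (n : nat) :
  admissible K X -> (forall k, (k < n)%N -> X (x k)) ->
  (forall i j, (i < j < n)%N -> x i < x j) ->
  good K (fun k =>
    if (k.+1 < n)%N then Num.min (x k.+1 - x k) (sup K) else sup K).
Proof.
move=> [_ XK] xX x_lt; set d := fun k => _.
have K1 y : K y -> 1 <= y by move=> /K_ge1; rewrite /= in_itv /= andbT.
have K_sup y : K y -> y <= sup K.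
  move=> Ky; rewrite leNgt; apply/negP => Kly.
  have [nKs|hK] := pselect (has_sup K); last first.
    by have := K1 _ supK; rewrite sup_out // ler10.
  by have := ub_le_sup (proj2 nKs) Ky; rewrite leNgt Kly.
have gap i j : (i < j < n)%N -> steps K (x j - x i).
  move=> /andP[ij jn]; have lt_x : 0 < x j - x i.
    by rewrite subr_gt0 x_lt ?ij.
  have := XK _ _ (xX _ jn) (xX _ (ltn_trans ij jn)); rewrite gtr0_norm //.
  case=> [[/= x0|]|]; first by rewrite x0 ltxx in lt_x.
    by left.
  by rewrite /= in_itv /= andbT => /ltW; exact: ge_sup_steps.
have dK k : K (d k).
  rewrite /d; case: ifP => // kn; have [lt_s|//] := ltP (x k.+1 - x k) (sup K).
  by apply: steps_lt_sup lt_s; apply: gap; rewrite ltnSn.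
split=> // i j ij.
have [[k /andP[ik kj] dk]|nd] :=
    pselect (exists2 k, (i <= k < j)%N & d k = sup K).
  apply: ge_sup_steps; rewrite -dk (@big_cat_nat _ _ _ k i j) ?(ltnW kj) //=.
  have d_ge0 l : 0 <= d l by apply: le_trans (K1 _ (dK l)).
  by rewrite (big_ltn kj) addrCA lerDl addr_ge0 // sumr_ge0.
have dE k : (i <= k < j)%N -> (k.+1 < n)%N /\ d k = x k.+1 - x k.
  move=> kij; have : d k <> sup K by move=> dk; apply: nd; exists k.
  by rewrite /d; case: ifP => // kn; rewrite minEle; case: ifP.
rewrite (@eq_big_nat _ _ _ _ _ _ (fun k => x k.+1 - x k)); last first.
  by move=> k /dE[].
rewrite telescope_sumr 1?ltnW //; apply: gap; rewrite ij /=.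
by have [|] := dE j.-1; rewrite ?prednK //; lia.
Qed.

(** The capped gaps sum to at most the spread [2 * a] of the centers. There is one gap fewer than
    centers, whence the extra [mu]; the sign hypothesis serves the empty list. *)
Lemma admissible_count {R : realType} {K X : set R} {mu B a : R}
    (K_ge1 : K `<=` `[1, +oo[) (supK : K (sup K)) (mu_ge0 : 0 <= mu)
    (mu_min : forall d n, good K d -> n%:R * mu <= \sum_(0 <= k < n) d k + B)
    (XK : admissible K X) (s : seq R) :
  uniq s -> (forall x, x \in s -> X x /\ `|x| <= a) ->
  0 <= 2 * a + B + mu ->
  (size s)%:R * mu <= 2 * a + B + mu.
Proof.
move=> s_uniq sX B_ge0; have [->|s0] := posnP (size s); first by rewrite mul0r.
pose t := sort <=%O s; pose x k := nth 0 t k.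
have size_t : size t = size s by rewrite size_sort.
have xX k : (k < size s)%N -> X (x k) /\ `|x k| <= a.
  by move=> kn; apply: sX; rewrite -(mem_sort <=%O) mem_nth ?size_t.
have t_sorted : sorted <%O t by rewrite sort_lt_sorted.
have x_lt i j : (i < j < size s)%N -> x i < x j.
  move=> /andP[ij jn]; apply: (sorted_ltn_nth lt_trans) => //.
    by rewrite inE size_t (ltn_trans ij).
  by rewrite inE size_t.
have gd := good_min_gap K_ge1 supK x (size s) XK (fun k kn => (xX k kn).1) x_lt.
have := mu_min _ (size s).-1 gd.
rewrite -[in X in _ -> X](prednK s0) -natr1 mulrDl mul1r => min_s.
rewrite lerD2r (le_trans min_s) // lerD2r.
apply: (@le_trans _ _ (\sum_(0 <= k < (size s).-1) (x k.+1 - x k))).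
  apply: ler_sum_nat => k /andP[_ kn]; rewrite ifT; last by lia.
  by rewrite ge_min lexx.
rewrite telescope_sumr //.
have [_] := xX (size s).-1 ltac:(by rewrite ltn_predL); have [_] := xX 0 s0.
by rewrite !ler_norml; lra.
Qed.

(** * Densities *)

Lemma packing_setP {R : realType} (X : set R) (y : R) :
  packing_set X y <-> exists2 x, X x & `[x - 2^-1, x + 2^-1]%classic y.
Proof.
split=> [[x Xx [_ [b + <-] <-]]|[x Xx]]; rewrite /= !in_itv /=.
  by move=> /andP[b1 b2]; exists x => //; rewrite in_itv /=; apply/andP;
    split; lra.
move=> /andP[y1 y2]; exists x => //; exists (y - x);
  last by rewrite addrC subrK.
exists (2 * (y - x)); last by rewrite mulKf.
by rewrite /= in_itv /=; apply/andP; split; lra.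
Qed.

Definition balls {R : realType} (s : seq R) : set R :=
  \big[setU/set0]_(x <- s) `[x - 2^-1, x + 2^-1]%classic.

Lemma measure_balls_le {R : realType} (s : seq R) :
  measurable (balls s) /\
  (lebesgue_measure (balls s)
    <= (size s)%:R%:E)%E.
Proof.
rewrite /balls; elim: s => [|x s [ms IHs]]; first by rewrite big_nil measure0;
  split.
rewrite big_cons; split; first exact: measurableU.
apply: le_trans (measureU2 _ _ _) _ => //=;
  rewrite -[(size s).+1]addn1 natrD EFinD.
rewrite addeC leeD // lebesgue_measure_itv /= lte_fin.
by case: ifP => _; rewrite -?EFinB lee_fin; lra.
Qed.

(** Half-open intervals stay disjoint even when consecutive balls touch, so their lengths add up
    exactly. *)
Lemma measure_balls_ge {R : realType} (x : nat -> R) (n : nat) :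
  (forall k, x k + 1 <= x k.+1) ->
  lebesgue_measure
    (\big[setU/set0]_(k < n) `[x k - 2^-1, x k + 2^-1[%classic : set R)
    = n%:R%:E.
Proof.
move=> x_gap; elim: n => [|n IHn]; first by rewrite big_ord0 measure0.
have x_lt i j : (i < j)%N -> x i + 1 <= x j.
  elim: j => // j IHj; rewrite ltnS leq_eqVlt => /predU1P[->//|/IHj].
  by have := x_gap j; lra.
rewrite big_ord_recr measureU //=; last 2 first.
- by apply: bigsetU_measurable.
- apply/seteqP; split=> // y [] /=; rewrite -(bigcup_mkord _ (fun k => `[x k -
  2^-1, x k + 2^-1[%classic)) => -[k /= kn].
  by rewrite !in_itv /= => /andP[_ yk] /andP[ny _]; have := x_lt _ _ kn; lra.
rewrite [X in (X + _)%E]IHn lebesgue_measure_itv /= lte_fin ifT; last by lra.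
by rewrite -EFinB -EFinD -[in RHS]natr1; congr (_ %:E); lra.
Qed.

Definition slice {R : realType} (X : set R) (t : R) : set R :=
  packing_set X `&` `[(- t / 2), (t / 2)]%classic.

(** A ball of radius 1/2 can meet the interval only if its center is within [t / 2 + 2^-1] of the
    origin. Finiteness of that list of centers also yields measurability. *)
Lemma packing_measure_le {R : realType} {X : set R} {s : seq R} {t : R} :
  (forall x : R, x \in s <-> X x /\ `|x| <= t / 2 + 2^-1) ->
  measurable (slice X t) /\
  (lebesgue_measure (slice X t)
    <= (size s)%:R%:E)%E.
Proof.
move=> sE; have [ms le_s] := measure_balls_le s.
have -> : slice X t = balls s `&` `[- t / 2, t / 2].
  rewrite /slice /balls; apply/seteqP; split=> [y [/packing_setP[x Xx xy] yt]|y
    [+ yt]].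
    split=> //; rewrite -bigcup_seq; exists x => //=; apply/sE; split=> //.
    move: xy yt; rewrite /= !in_itv /= ler_norml => /andP[? ?] /andP[? ?].
    by apply/andP; split; lra.
  rewrite -bigcup_seq => -[x /= /sE[Xx _] xy].
  by split=> //; apply/packing_setP; exists x.
have mI : measurable (balls s `&` `[- t / 2, t / 2]) by exact: measurableI.
split=> //; apply: le_trans le_s; apply: le_measure; rewrite ?inE //.
Qed.

Lemma dens_le {R : realType} {X : set R} {mu C : R} : 0 < mu ->
  (forall t, 0 < t -> exists2 s : seq R,
    (forall x : R, x \in s <-> X x /\ `|x| <= t / 2 + 2^-1) &
    (size s)%:R * mu <= t + C) ->
  (dens (packing_set X) <= (mu^-1)%:E)%E.
Proof.
move=> mu0 count; apply/lee_addgt0Pr => e e0.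
(* Beyond [C / (mu * e)] the error [C] contributes less than [e] to the density. *)
pose T0 := Num.max 0 (C / (mu * e)); pose V := [set t : R | T0 < t].
have Vpinfty : pinfty_nbhs R V by exists T0; split=> //; exact: num_real.
apply: le_trans (ereal_inf_lbound _) _; first by exists V => //; reflexivity.
apply: ge_ereal_sup => _ [t + <-]; rewrite /V /= gt_max => /andP[t0 Ct].
have [s sE le_s] := count t t0; have [_ le_m] := packing_measure_le sE.
apply: (@le_trans _ _ ((size s)%:R%:E * (t^-1)%:E)%E).
  by rewrite lee_wpmul2r // lee_fin invr_ge0 ltW.
rewrite -EFinM -EFinD lee_fin ler_pdivrMr //.
have : (size s)%:R <= (t + C) / mu by rewrite ler_pdivlMr.
move=> /le_trans; apply; rewrite mulrDl mulrDl [t / mu]mulrC lerD2l.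
by move: Ct; rewrite !ltr_pdivrMr ?ler_pdivrMr ?mulr_gt0 //; nra.
Qed.

(** Every neighbourhood of infinity contains some [t m], so counting centers along this sequence
    bounds the limsup from below. *)
Lemma dens_ge {R : realType} {X : set R} {mu : R} {t : nat -> R} : 0 < mu ->
  (forall a : R, exists m, a < t m) ->
  (forall m, 0 < t m -> measurable (slice X (t m))) ->
  (forall m, 0 < t m -> exists (x : nat -> R) n,
    [/\ forall k, x k + 1 <= x k.+1,
      forall k, (k < n)%N -> X (x k) /\ - t m / 2 <= x k - 2^-1 /\ x k + 2^-1
        <= t m / 2 &
      t m <= n%:R * mu + 1]) ->
  ((mu^-1)%:E <= dens (packing_set X))%E.
Proof.
move=> mu0 t_oo mP count; apply: le_ereal_inf_tmp => _ [V [T0 [_ VT0]] <-].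
apply/lee_addgt0Pr => e e0.
(* The bound [(mu * e)^-1] makes the boundary loss [1 / (mu * t m)] smaller than [e]. *)
have [m] := t_oo (Num.max (Num.max 0 T0) (mu * e)^-1).
rewrite !gt_max => /andP[/andP[t0 tT0] te].
have [x [n [x_gap xX tn]]] := count m t0.
have le_m : (n%:R%:E <= lebesgue_measure (slice X (t m)))%E.
  rewrite -(measure_balls_ge x n x_gap); apply: le_measure; rewrite ?inE.
  - by apply: bigsetU_measurable.
  - exact: mP.
  move=> y; rewrite -(bigcup_mkord _ (fun k => `[x k - 2^-1, x k +
    2^-1[%classic)) => -[k /= kn]; rewrite in_itv /= => /andP[y1 y2].
  have [Xk [xk1 xk2]] := xX k kn; split.
    by apply/packing_setP; exists (x k) => //=; rewrite in_itv /= y1 ltW.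
  by rewrite /= in_itv /=; apply/andP; split; lra.
apply: (@le_trans _ _ ((n%:R / t m)%:E + e%:E)%E); last first.
  rewrite leeD2r //; apply: ereal_sup_ge.
  exists (lebesgue_measure (slice X (t m))
        * ((t m)^-1)%:E)%E; first by exists (t m) => //; exact: VT0.
  by rewrite EFinM lee_wpmul2r // lee_fin invr_ge0 ltW.
rewrite -EFinD lee_fin -lerBlDr ler_pdivlMr //.
have : (t m - 1) / mu <= n%:R by rewrite ler_pdivrMr // lerBlDr.
apply: le_trans; rewrite !mulrBl mul1r [t m / mu]mulrC lerD2l lerN2.
by move: te; rewrite -div1r ltr_pdivrMr ?mulr_gt0 // -div1r ler_pdivrMr //; nra.
Qed.

(** * Periodic packings *)

Lemma admissible_of_steps {R : realType} {K X : set R} :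
  K `<=` `[1, +oo[ -> K (sup K) ->
  (forall x y, X x -> X y -> x = y \/ steps K `|x - y|) -> admissible K X.
Proof.
move=> K_ge1 supK XK; have K1 x : K x -> 1 <= x.
  by move=> /K_ge1; rewrite /= in_itv /= andbT.
split=> x y Xx Xy; have [->|] := XK _ _ Xx Xy.
- by left; rewrite /= subrr normr0.
- move=> [Kxy|]; right; rewrite /= in_itv /= andbT; first exact: K1.
  move: b; rewrite /= in_itv /= andbT; apply: le_trans; exact: K1.
- by left; left; rewrite /= subrr normr0.
move=> [Kxy|]; first by left; right.
rewrite /= in_itv /= andbT le_eqVlt => /predU1P[<-|lt_xy]; first by left; right.
by right; rewrite /= in_itv /= andbT.
Qed.

(** The bound on duplicate-free lists of centers forces finiteness, and then applies to the full
    list. The 1 in the constant comes from [2 * a = t + 1]. *)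
Lemma finite_admissible_slice {R : realType} {K X : set R} {mu B : R} :
  K `<=` `[1, +oo[ -> K (sup K) -> 0 < mu -> 0 <= B ->
  (forall d n, good K d -> n%:R * mu <= \sum_(0 <= k < n) d k + B) ->
  admissible K X -> forall t, 0 < t -> exists2 s : seq R,
    (forall x : R, x \in s <-> X x /\ `|x| <= t / 2 + 2^-1) &
    (size s)%:R * mu <= t + (1 + B + mu).
Proof.
move=> K_ge1 supK mu0 B0 mu_min XK t t0.
pose a := t / 2 + 2^-1; pose A := [set x : R | X x /\ `|x| <= a].
have count s : uniq s -> (forall x, x \in s -> X x /\ `|x| <= a) ->
    (size s)%:R * mu <= 2 * a + B + mu.
  move=> us sX; apply: (admissible_count K_ge1 supK (ltW mu0) mu_min XK) => //.
  by rewrite /a; lra.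
have finA : finite_set A.
  apply: contrapT => infA.
  have [C CA] := infinite_set_fset (Num.trunc ((2 * a + B + mu) / mu)).+1 infA.
  have sC : (size (finmap.enum_fset C))%:R * mu <= 2 * a + B + mu.
    by apply: count => [|x xC]; [exact: finmap.fset_uniq | exact: CA].
  apply/negP; rewrite -ltnNge -(ltr_nat R).
  apply: le_lt_trans (truncnS_gt ((2 * a + B + mu) / mu)).
  by rewrite ler_pdivlMr.
have [s sE] := (finite_seqP _).1 finA.
have usE x : x \in undup s <-> X x /\ `|x| <= a.
  rewrite mem_undup; change ([set` s] x <-> A x).
  by rewrite sE.
exists (undup s) => //.
have := count _ (undup_uniq s) (fun x => (usE x).1).
by rewrite /a => /le_trans; apply; lra.
Qed.

Lemma periodic_sum {R : realType} {d : nat -> R} {p : nat} :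
  (forall k, d (k + p)%N = d k) -> forall k m,
  \sum_(0 <= i < k + m * p) d i =
    \sum_(0 <= i < k) d i + m%:R * \sum_(0 <= i < p) d i.
Proof.
move=> d_per k; elim=> [|m IHm]; first by rewrite addn0 mul0r addr0.
rewrite mulSn addnCA (@big_cat_nat _ _ _ p) ?leq_addr //=.
have -> : \sum_(p <= i < p + (k + m * p)) d i = \sum_(0 <= i < k + m * p) d i.
  rewrite -{1}[p]add0n big_addn addKn; apply: eq_bigr => i _; exact: d_per.
by rewrite IHm -natr1 mulrDl mul1r addrC addrA.
Qed.

Definition periodic_points {R : realType} (d : nat -> R) (p : nat) : set R :=
  minkowski_sum (lattice (\sum_(0 <= k < p) d k))
    [set \sum_(0 <= k < i) d k | i in `I_p].

Lemma periodic_pointsP {R : realType} {d : nat -> R} {p : nat} (x : R) :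
  (0 < p)%N -> (forall k, d (k + p)%N = d k) ->
  periodic_points d p x <-> exists (z : int) (k : nat),
    x = z%:~R * (\sum_(0 <= i < p) d i) + \sum_(0 <= i < k) d i.
Proof.
move=> p0 d_per; split=> [[_ [z _ <-] [_ [k _ <-] <-]]|[z [k ->]]].
  by exists z, k.
exists ((z + (k %/ p)%:Z)%:~R * \sum_(0 <= i < p) d i);
  first by exists (z + (k %/ p)%:Z).
exists (\sum_(0 <= i < k %% p) d i); first by exists (k %% p)%N;
  rewrite //= ltn_mod.
rewrite [in RHS](divn_eq k p) addnC periodic_sum // rmorphD /= mulrDl.
by rewrite -addrA [X in _ + X = _]addrC.
Qed.

(** Moving the base far enough to the left writes both points as partial sums of [d] from a common
    origin, so their distance is a block sum of the word. *)
Lemma periodic_points_diff {R : realType} {d : nat -> R} {p : nat} (x y : R) :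
  (0 < p)%N -> (forall k, d (k + p)%N = d k) ->
  periodic_points d p x -> periodic_points d p y -> exists (c : R) (a b : nat),
    x = c + \sum_(0 <= i < a) d i /\ y = c + \sum_(0 <= i < b) d i.
Proof.
move=> p0 d_per /(periodic_pointsP _ p0 d_per)[z [i ->]].
move=> /(periodic_pointsP _ p0 d_per)[z' [j ->]].
have [z0 [m [m' [-> ->]]]] : exists (z0 : int) (m m' : nat), z = z0 + m%:Z /\
  z' = z0 + m'%:Z.
  by exists (- (`|z| + `|z'|)%:Z), (absz (z + `|z| + `|z'|)), (absz (z' + `|z|
    + `|z'|)); lia.
exists (z0%:~R * \sum_(0 <= k < p) d k), (i + m * p)%N, (j + m' * p)%N.
by rewrite !periodic_sum // !rmorphD /=; split; ring.
Qed.

Theorem theorem2p5 (R : realType) (K : set R)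
  (K_ge1 : K `<=` `[1, +oo[)
  (K_compact : compact K)
  (K_1 : K 1)
  (K_left : left_accumulation K = set0)
  (K_right : finite_set (right_accumulation K))
  (K_sum : minkowski_sum (limit_point K) (limit_point K) `&` limit_point K
           = set0) :
  exists X : set R,
    [/\ admissible K X, is_periodic_packing X & dens (packing_set X) = Delta1 K].
Proof.
have [d [p [mu [B [[p0 d_per d_good] [d_mu mu_min]]]]]] :=
  optimal_gaps K_ge1 K_compact K_1 K_left K_right K_sum.
have supK : K (sup K) by apply: sup_in_compact => //; exists 1.
have d1 k : 1 <= d k.
  by have [/(_ k)/K_ge1] := d_good; rewrite /= in_itv /= andbT.
pose S k := \sum_(0 <= i < k) d i.
have p_gt0 : 0 < p%:R :> R by rewrite ltr0n.
have S_gap k : S k + 1 <= S k.+1 by rewrite /S big_nat_recr //= lerD2l.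
have S_le i j : (i <= j)%N -> S i <= S j.
  move=> ij; rewrite /S (@big_cat_nat _ _ _ i 0 j) //= lerDl sumr_ge0 // => k _.
  exact: le_trans (d1 k).
have mu1 : 1 <= mu.
  rewrite -(ler_pM2l p_gt0) -d_mu mulr1 -[X in X%:R](subn0 p) -sumr_const_nat.
  by apply: ler_sum_nat => k _.
have mu0 : 0 < mu by apply: lt_le_trans mu1.
have B0 : 0 <= B by have := mu_min d 0 d_good; rewrite mul0r big_geq // add0r.
have slices (X : set R) := @finite_admissible_slice R K X mu B K_ge1 supK mu0
  B0 mu_min.
pose X := periodic_points d p.
have XK : admissible K X.
  apply: admissible_of_steps => // x y Xx Xy.
  have [c [a [b [-> ->]]]] := periodic_points_diff _ _ p0 d_per Xx Xy.
  rewrite opprD addrACA subrr add0r.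
  wlog ab : a b / (a <= b)%N.
    move=> Hw; have [/Hw//|/ltnW/Hw] := leqP a b.
    by rewrite distrC => -[->|]; [left|right].
  move: ab; rewrite leq_eqVlt => /predU1P[->|ab]; first by left.
  right; rewrite (@big_cat_nat _ _ _ a 0 b) //=; last exact: ltnW.
  rewrite opprD addrA subrr add0r normrN ger0_norm;
    first by have [_] := d_good; apply.
  by apply: sumr_ge0 => k _; apply: le_trans (d1 k).
exists X; split=> //.
  exists (\sum_(0 <= k < p) d k), [set \sum_(0 <= k < i) d k | i in `I_p].
  split=> //; first by rewrite d_mu mulr_gt0.
    exact/finite_image/finite_II.
  by exists (S 0%N), 0%N.
apply/eqP; rewrite eq_le; apply/andP; split.
  by apply: ereal_sup_ubound; exists X.
apply: (@le_trans _ _ (mu^-1)%:E).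
  by apply: ge_ereal_sup => _ [Y YK <-]; exact: dens_le mu0 (slices Y YK).
(* The interval spans [m] periods on each side of the origin, with room 1/2 at both ends for the
   balls. *)
pose t m : R := 2 * m%:R * (p%:R * mu) + 1.
have pmu1 : 1 <= p%:R * mu by rewrite mulr_ege1 // ler1n.
apply: (@dens_ge _ _ _ t) => //.
- move=> a; exists (Num.trunc a).+1; rewrite /t.
  have := truncnS_gt a; have : 0 <= (Num.trunc a).+1%:R :> R by [].
  by move: (_%:R) => m; nra.
- move=> m tm0; have [s sE _] := slices X XK _ tm0.
  by have [] := packing_measure_le sE.
(* The centers are those of [2 * m] consecutive periods, starting [m] periods left of the origin;
   the length bound is then an equality. *)
move=> m _; exists (fun k => S k - m%:R * (p%:R * mu)), (2 * m * p)%N.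
have S2 : S (2 * m * p)%N = 2 * m%:R * (p%:R * mu).
  by rewrite /S -[X in index_iota _ X]add0n periodic_sum // big_geq // add0r
    d_mu natrM.
split=> [k|k kn|]; first by have := S_gap k; lra.
  have := S_le _ _ kn; have := S_gap k; have := S_le 0%N k (leq0n k).
  rewrite S2 /t {1}/S big_geq // => Sk0 Sk1 Sk2; split; last by split; lra.
  apply/(periodic_pointsP _ p0 d_per); exists (- m%:Z), k.
  by rewrite d_mu addrC mulrNz mulNr.
by rewrite /t !natrM; lra.
Qed.
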